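(* Let $\mathcal{R}$ be the hyperfinite type II$_1$ factor and let $\mathcal{R}_\infty=\bigcup_{n=1}^\infty\mathcal{R}_n$ be the union of the increasing sequence of matrix $\ast$-subalgebras $\mathcal{R}_n\subset\mathcal{R}$ generated by the system of matrix units $\{e^{(n)}_{ij}\}$ described in the context. Then the algebra $\mathcal{R}_\infty$ admits an algebra automorphism which is discontinuous in the measure topology.
   Context: $\mathcal{R}$ is the hyperfinite II$_1$ factor with faithful normal normalised trace $\tau$. Fix a system of matrix units $\{e^{(n)}_{ij}: n=0,1,\dots,\ i,j=1,\dots,2^n\}$ in $\mathcal{R}$, with $e^{(0)}_{1,1}=\mathbf{1}$, such that (a) $e^{(n)}_{ij}e^{(n)}_{kl}=\delta_{jk}e^{(n)}_{il}$; (b) $(e^{(n)}_{ij})^*=e^{(n)}_{ji}$; (c) $\sum_{i=1}^{2^n}e^{(n)}_{ii}=\mathbf{1}$; (d) $e^{(n)}_{ij}=e^{(n+1)}_{2i-1,2j-1}+e^{(n+1)}_{2i,2j}$. For each $n$, $\mathcal{R}_n$ is the $\ast$-subalgebra of $\mathcal{R}$ generated by $\{e^{(n)}_{ij}: i,j=1,\dots,2^n\}$; it is $\ast$-isomorphic to the algebra of complex $2^n\times 2^n$ matrices, and $\mathcal{R}_0\subset\mathcal{R}_1\subset\cdots$. An algebra automorphism is a complex-linear multiplicative bijection of the algebra onto itself (not required to preserve $\ast$). Let $S(\mathcal{R})$ be the $\ast$-algebra of all (densely defined closed) operators affiliated with $\mathcal{R}$ and $P(\mathcal{R})$ the set of projections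 of $\mathcal{R}$. The measure topology on $S(\mathcal{R})$ is the vector topology with basic neighbourhoods of zero $N(\varepsilon,\delta)=\{x\in S(\mathcal{R}):\exists\, e\in P(\mathcal{R}),\ \tau(\mathbf{1}-e)\le\delta,\ xe\in\mathcal{R},\ \|xe\|\le\varepsilon\}$, $\varepsilon,\delta>0$. $\mathcal{R}_\infty\subset\mathcal{R}\subset S(\mathcal{R})$ carries the induced topology. *)

(* Defs.v *)
From mathcomp Require Import all_boot all_order all_algebra.
From mathcomp Require Import sesquilinear.
From mathcomp Require Import complex.
From mathcomp Require Import all_classical all_reals all_analysis.

Set Implicit Arguments.
Unset Strict Implicit.
Unset Printing Implicit Defensive.

Import Order.TTheory GRing.Theory Num.Theory.
Import numFieldNormedType.Exports.

Local Open Scope classical_set_scope.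
Local Open Scope complex_scope.
Local Open Scope ring_scope.

(* A Hilbert space is a complete normed space over K[i] together with a
   positive definite Hermitian form, linear in its first argument, that induces
   the norm ([is_hilbert]).  Bounded operators are functions H -> H, so that
   sums, scalar multiples and composites are the pointwise ones; a von Neumann
   algebra is a set of such functions. *)

Section Operators.
Variables (K : realType) (H : completeNormedModType K[i]).
Variable dot : {dot H for @Num.conj K[i]}.
Implicit Types (S T : H -> H) (A M : set (H -> H)).

Definition is_hilbert : Prop := forall u : H, `|u| ^+ 2 = dot u u.

Definition bounded_op T : Prop :=
  linear T /\ exists c : K, forall u, `|T u| <= c%:C * `|u|.

Definition op_norm T : K :=
  inf [set c : K | 0 <= c /\ forall u, `|T u| <= c%:C * `|u|].

Definition is_adjoint T S : Prop := forall u v, dot (T u) v = dot u (S v).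

Definition op_le S T : Prop := forall u, 0 <= dot ((T - S) u) u.

Record star_subalgebra A : Prop := StarSubalgebra {
  star_bounded : forall T, A T -> bounded_op T;
  star_one : A idfun;
  star_lin : forall (a : K[i]) S T, A S -> A T -> A (a *: S + T);
  star_mul : forall S T, A S -> A T -> A (S \o T);
  star_adj : forall T, A T -> exists2 S, A S & is_adjoint T S }.

Definition commutant A : set (H -> H) :=
  [set T | bounded_op T /\ forall S, A S -> T \o S = S \o T].

Definition von_neumann_algebra M : Prop :=
  star_subalgebra M /\ commutant (commutant M) = M.

Definition factor M : Prop :=
  von_neumann_algebra M /\
  M `&` commutant M = [set T | exists a : K[i], T = a *: idfun].

Definition projection M : set (H -> H) :=
  [set p | [/\ M p, p \o p = p & is_adjoint p p]].

Definition finite_algebra M : Prop :=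
  forall v w, M v -> M w -> is_adjoint v w -> w \o v = idfun -> v \o w = idfun.

Definition abelian_projection M p : Prop :=
  projection M p /\
  forall S T, M S -> M T ->
    (p \o S \o p) \o (p \o T \o p) = (p \o T \o p) \o (p \o S \o p).

Definition typeII1_factor M : Prop :=
  [/\ factor M, finite_algebra M &
      forall p, abelian_projection M p -> p = 0].

Definition finite_dimensional A : Prop :=
  exists (m : nat) (b : 'I_m -> H -> H),
    forall T, A T -> exists c : 'I_m -> K[i], T = \sum_(i < m) c i *: b i.

(* The double commutant is the von Neumann algebra generated by a self-adjoint
   set of operators. *)
Definition hyperfinite M : Prop :=
  exists A : nat -> set (H -> H),
    [/\ forall n, star_subalgebra (A n) /\ finite_dimensional (A n),
        forall n, A n `<=` A n.+1
      & commutant (commutant (\bigcup_n A n)) = M].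

Definition hyperfinite_II1_factor M : Prop :=
  typeII1_factor M /\ hyperfinite M.

Definition normal_functional M (tau : (H -> H) -> K[i]) : Prop :=
  forall (D : set (H -> H)) (x : H -> H),
    D !=set0 -> (forall T, D T -> M T /\ op_le 0 T) ->
    (forall S T, D S -> D T -> exists U, [/\ D U, op_le S U & op_le T U]) ->
    M x -> (forall T, D T -> op_le T x) ->
    (forall y, M y -> (forall T, D T -> op_le T y) -> op_le x y) ->
    (forall T, D T -> tau T <= tau x) /\
    (forall c, (forall T, D T -> tau T <= c) -> tau x <= c).

(* Only the values of tau on M matter. *)
Record faithful_normal_trace M (tau : (H -> H) -> K[i]) : Prop :=
  FaithfulNormalTrace {
  trace_lin : forall (a : K[i]) S T, M S -> M T ->
    tau (a *: S + T) = a * tau S + tau T;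
  trace_cyclic : forall S T, M S -> M T -> tau (S \o T) = tau (T \o S);
  trace_ge0 : forall T, M T -> op_le 0 T -> 0 <= tau T;
  trace_faithful : forall T, M T -> op_le 0 T -> tau T = 0 -> T = 0;
  trace_normal : normal_functional M tau;
  trace_one : tau idfun = 1 }.

(* [e n i j] is the matrix unit e^(n)_{ij}, with 1-based indices; its values
   outside 1 <= i, j <= 2^n are irrelevant. *)
Definition unit_index (n i : nat) : bool := (0 < i <= 2 ^ n)%N.

Record matrix_units M (e : nat -> nat -> nat -> H -> H) : Prop :=
  MatrixUnits {
  mu_in : forall n i j, unit_index n i -> unit_index n j -> M (e n i j);
  mu_zero : e 0%N 1%N 1%N = idfun;
  mu_mul : forall n i j k l,
    unit_index n i -> unit_index n j -> unit_index n k -> unit_index n l ->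
    e n i j \o e n k l = (j == k)%:R *: e n i l;
  mu_adj : forall n i j, unit_index n i -> unit_index n j ->
    is_adjoint (e n i j) (e n j i);
  mu_sum : forall n, \sum_(1 <= i < (2 ^ n).+1) e n i i = idfun;
  mu_split : forall n i j, unit_index n i -> unit_index n j ->
    e n i j = e n.+1 (2 * i - 1)%N (2 * j - 1)%N + e n.+1 (2 * i)%N (2 * j)%N }.

Definition star_generated (G : set (H -> H)) : set (H -> H) :=
  [set T | forall A, star_subalgebra A -> G `<=` A -> A T].

Definition R_ (e : nat -> nat -> nat -> H -> H) (n : nat) : set (H -> H) :=
  star_generated
    [set T | exists i j, [/\ unit_index n i, unit_index n j & T = e n i j]].

Definition Rinf (e : nat -> nat -> nat -> H -> H) : set (H -> H) :=
  \bigcup_(n in [set n | (1 <= n)%N]) R_ e n.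

(* Unbounded operators are represented by their graphs, subsets of H * H. *)

Definition graph T : set (H * H) := [set p | p.2 = T p.1].

Record closed_op (X : set (H * H)) : Prop := ClosedOp {
  cop_zero : X (0, 0);
  cop_lin : forall (a : K[i]) u v u' v', X (u, v) -> X (u', v') ->
    X (a *: u + u', a *: v + v');
  cop_fun : forall v, X (0, v) -> v = 0;
  cop_dense : dense [set u | exists v, X (u, v)];
  cop_closed : closed X }.

(* S(M).  Invariance of the graph under M' is affiliation: it says that T X is
   contained in X T for every T in M'. *)
Definition affiliated M : set (set (H * H)) :=
  [set X | closed_op X /\
    forall T, commutant M T -> forall u v, X (u, v) -> X (T u, T v)].

(* The difference in S(M): the closure of the pointwise difference on the
   intersection of the domains. *)
Definition strong_sub (X Y : set (H * H)) : set (H * H) :=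
  closure [set p | exists v w, [/\ X (p.1, v), Y (p.1, w) & p.2 = v - w]].

(* The product of a closed operator by a bounded one is closed, so no closure is
   needed for x e. *)
Definition comp_op (X : set (H * H)) T : set (H * H) :=
  [set p | X (T p.1, p.2)].

Definition measure_ball M (tau : (H -> H) -> K[i]) (eps del : K) :
    set (set (H * H)) :=
  [set X | affiliated M X /\
    exists p, [/\ projection M p, tau (idfun - p) <= del%:C &
      exists b, [/\ M b, comp_op X p = graph b & op_norm b <= eps]]].

(* The neighbourhood filter of X in S(M) for the measure topology. *)
Definition measure_nbhs M (tau : (H -> H) -> K[i]) (X : set (H * H)) :
    set_system (set (H * H)) :=
  filter_from [set ed : K * K | 0 < ed.1 /\ 0 < ed.2]
    (fun ed => [set Y | affiliated M Y /\
                  measure_ball M tau ed.1 ed.2 (strong_sub Y X)]).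

(* The neighbourhood filter of x in a subset A of M, for the topology induced
   by S(M) through x |-> graph x. *)
Definition induced_nbhs M (tau : (H -> H) -> K[i]) A (x : H -> H) :
    set_system (H -> H) :=
  filter_from (measure_nbhs M tau (graph x)) (fun V => A `&` graph @^-1` V).

Definition measure_continuous M (tau : (H -> H) -> K[i]) A
    (Phi : (H -> H) -> (H -> H)) : Prop :=
  forall x, A x ->
    Phi @ induced_nbhs M tau A x --> induced_nbhs M tau A (Phi x).

Record algebra_automorphism A (Phi : (H -> H) -> (H -> H)) : Prop :=
  AlgebraAutomorphism {
  aut_bij : set_bij A A Phi;
  aut_lin : forall (a : K[i]) S T, A S -> A T ->
    Phi (a *: S + T) = a *: Phi S + Phi T;
  aut_mul : forall S T, A S -> A T -> Phi (S \o T) = Phi S \o Phi T }.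

End Operators.

(* Main.v *)
(** In the tensor decomposition of R_oo into 2x2 matrix factors, let N_k and q_k
    be the matrices [[0,1],[0,0]] and [[0,0],[0,1]] of the k-th factor, and
    conjugate the k-th factor by 1 + k N_k.  On R_n only the first n factors
    matter, so this gives an automorphism Phi of the union although the infinite
    product of the conjugators does not exist.  Phi maps q_k / k, which tends to
    0 in norm, to q_k / k + N_k.  Multiplying by N_k^* on the left turns the
    latter into q_k, so if its restriction to a projection p has norm < r then
    1/2 = tau (q_k) <= r^2 + tau (1 - p), and it stays away from 0 in measure. *)
From HB Require Import structures.
Require Import Defs.
From mathcomp Require Import all_boot all_order all_algebra.
From mathcomp Require Import sesquilinear.
From mathcomp Require Import complex.
From mathcomp Require Import all_classical all_reals all_analysis.
From mathcomp Require Import zify lra.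
Set Implicit Arguments.
Unset Strict Implicit.
Unset Printing Implicit Defensive.
Import Order.TTheory GRing.Theory Num.Theory.
Import numFieldNormedType.Exports.
Local Open Scope classical_set_scope.
Local Open Scope complex_scope.
Local Open Scope ring_scope.

(** * Composition of operators with pointwise sums and scalar multiples *)

Section Composition.
Variables (R : nzRingType) (V : lmodType R).
Implicit Types (S T : V -> V).

Lemma comp_sumr (T : V -> V) I (r : seq I) (P : pred I) (F : I -> V -> V) :
  linear T -> T \o (\sum_(i <- r | P i) F i) = \sum_(i <- r | P i) (T \o F i).
Proof.
move=> lT; pose T' : {linear V -> V} := HB.pack T (GRing.isLinear.Build _ _ _ _ T lT).
apply/funext => x /=; rewrite !fct_sumE.
exact: (linear_sum T').
Qed.

Lemma comp_suml T I (r : seq I) (P : pred I) (F : I -> V -> V) :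
  (\sum_(i <- r | P i) F i) \o T = \sum_(i <- r | P i) (F i \o T).
Proof. by apply/funext => x /=; rewrite !fct_sumE. Qed.

Lemma comp_scaler T a S : linear T -> T \o (a *: S) = a *: (T \o S).
Proof.
move=> lT; pose T' : {linear V -> V} := HB.pack T (GRing.isLinear.Build _ _ _ _ T lT).
apply/funext => x; exact: (linearZ_LR T').
Qed.

Lemma comp_addr T S S' : linear T -> T \o (S + S') = (T \o S) + (T \o S').
Proof.
by move=> lT; apply/funext => x; have := lT 1 (S x) (S' x); rewrite !scale1r.
Qed.

Lemma linear_fun0 T : linear T -> T 0 = 0.
Proof.
by move=> lT; have := lT (-1) 0 0; rewrite !scaler0 addr0 => ->; rewrite scaleN1r addNr.
Qed.

End Composition.

(** * Adjoints, star subalgebras and the star subalgebra generated by a set *)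

Section StarSubalgebra.
Variables (K : realType) (H : completeNormedModType K[i]).
Variable dot : {dot H for @Num.conj K[i]}.
Implicit Types (S T U : H -> H) (A : set (H -> H)).

Lemma dotC u v : dot u v = (dot v u)^*.
Proof. by have := hermC dot u v; rewrite expr0 mul1r. Qed.

Lemma dotDr u v w : dot u (v + w) = dot u v + dot u w.
Proof. exact: linearDr. Qed.

Lemma dotDl u v w : dot (u + v) w = dot u w + dot v w.
Proof. exact: linearDl. Qed.

Lemma dotBr u v w : dot u (v - w) = dot u v - dot u w.
Proof. exact: linearBr. Qed.

Lemma dotBl u v w : dot (u - v) w = dot u w - dot v w.
Proof. exact: linearBl. Qed.

Lemma dotZl a u v : dot (a *: u) v = a * dot u v.
Proof. exact: linearZl_LR. Qed.

Lemma dot_eq0 u : dot u u = 0 -> u = 0.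
Proof. by move/eqP; rewrite (dnorm_eq0 dot) => /eqP. Qed.

Lemma is_adjoint_sym S T : is_adjoint dot S T -> is_adjoint dot T S.
Proof. by move=> adj u v; rewrite dotC [RHS]dotC adj. Qed.

Lemma adjoint_uniq T S S' : is_adjoint dot T S -> is_adjoint dot T S' -> S = S'.
Proof.
move=> adj adj'; apply/funext => v; apply/eqP; rewrite -subr_eq0; apply/eqP.
by apply: dot_eq0; rewrite dotBr -adj -adj' subrr.
Qed.

Lemma adjoint_comp S S' T T' : is_adjoint dot S S' -> is_adjoint dot T T' ->
  is_adjoint dot (S \o T) (T' \o S').
Proof. by move=> adjS adjT u v /=; rewrite adjS adjT. Qed.

Lemma adjoint_sum I (r : seq I) (P : pred I) (F G : I -> H -> H) :
  (forall i, P i -> is_adjoint dot (F i) (G i)) ->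
  is_adjoint dot (\sum_(i <- r | P i) F i) (\sum_(i <- r | P i) G i).
Proof.
move=> adj; apply: (big_rec2 (is_adjoint dot)) => [u v|i S T Pi adjST u v].
  by rewrite [LHS](linear0l dot) [RHS](linear0r dot).
by rewrite dotDr -adj // -adjST -dotDl.
Qed.

Section Closure.
Variables (A : set (H -> H)) (sA : star_subalgebra dot A).

Lemma star_linear T : A T -> linear T.
Proof. by move=> /(star_bounded sA)[]. Qed.

Lemma star_zero : A 0.
Proof.
by have := star_lin sA (-1) (star_one sA) (star_one sA); rewrite scaleN1r addNr.
Qed.

Lemma star_add S T : A S -> A T -> A (S + T).
Proof. by move=> AS AT; rewrite -[S]scale1r; apply: (star_lin sA). Qed.

Lemma star_scale a T : A T -> A (a *: T).
Proof. by move=> AT; rewrite -[_ *: _]addr0; apply: (star_lin sA) => //; apply: star_zero. Qed.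

Lemma star_sub S T : A S -> A T -> A (S - T).
Proof. by move=> AS AT; apply: star_add => //; rewrite -scaleN1r; apply: star_scale. Qed.

Lemma star_sum I (r : seq I) (P : pred I) (F : I -> H -> H) :
  (forall i, P i -> A (F i)) -> A (\sum_(i <- r | P i) F i).
Proof. by move=> AF; apply: big_ind => //; [exact: star_zero | exact: star_add]. Qed.

Lemma star_adjoint T S : A T -> is_adjoint dot T S -> A S.
Proof. by move=> /(star_adj sA)[S' AS' adj'] /(adjoint_uniq adj') <-. Qed.

(** The ambient [A] supplies boundedness and an adjoint; since adjoints are unique, that same
    adjoint lies in every star subalgebra containing [G]. *)
Lemma star_generated_subalgebra (G : set (H -> H)) :
  G `<=` A -> star_subalgebra dot (star_generated dot G).
Proof.
move=> GA; split.
- by move=> T /(_ A sA GA) /(star_bounded sA).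
- by move=> B sB _; apply: star_one sB.
- by move=> a S T GS GT B sB GB; apply: (star_lin sB); [apply: GS|apply: GT].
- by move=> S T GS GT B sB GB; apply: (star_mul sB); [apply: GS|apply: GT].
- move=> T GT; have [S _ adj] := star_adj sA (GT A sA GA).
  exists S => // B sB GB; have [S' BS' adj'] := star_adj sB (GT B sB GB).
  by rewrite (adjoint_uniq adj adj').
Qed.

(** The elements of [A] commuting with both [S] and [S'] form a star subalgebra containing [G]. Both
    relations are imposed because taking adjoints exchanges them. *)
Lemma star_generated_commute (G : set (H -> H)) S S' :
  G `<=` A -> A S -> is_adjoint dot S S' ->
  (forall T, G T -> T \o S = S \o T /\ T \o S' = S' \o T) ->
  forall T, star_generated dot G T -> T \o S = S \o T.
Proof.
move=> GA AS adj comm T GT.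
have lS := star_linear AS; have AS' := star_adjoint AS adj.
have lS' := star_linear AS'.
pose B := [set U | [/\ A U, U \o S = S \o U & U \o S' = S' \o U]].
suff sB : star_subalgebra dot B.
  by have [] := GT B sB (fun U GU => And3 (GA _ GU) (comm U GU).1 (comm U GU).2).
split.
- by move=> U [/(star_bounded sA)].
- by split => //; apply: star_one sA.
- move=> a U V [AU US US'] [AV VS VS']; split; first exact: star_lin sA _ _ _ AU AV.
  + by rewrite comp_addr // comp_scaler // -US -VS.
  + by rewrite comp_addr // comp_scaler // -US' -VS'.
- move=> U V [AU US US'] [AV VS VS']; split; first exact: star_mul sA _ _ AU AV.
  + by rewrite -compA VS compA US.
  + by rewrite -compA VS' compA US'.
- move=> U [AU US US']; have [U' AU' adjU] := star_adj sA AU.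
  exists U' => //; split => //.
  + apply: (@adjoint_uniq (S' \o U)); first exact: adjoint_comp (is_adjoint_sym adj) adjU.
    by rewrite -US'; exact: adjoint_comp adjU (is_adjoint_sym adj).
  + apply: (@adjoint_uniq (S \o U)); first exact: adjoint_comp adj adjU.
    by rewrite -US; exact: adjoint_comp adjU adj.
Qed.

End Closure.
End StarSubalgebra.

(** * Matrix units of a single tensor factor *)

Section Twist.
Variables (K : realType) (H : completeNormedModType K[i]).
Variable dot : {dot H for @Num.conj K[i]}.
Variables (M : set (H -> H)) (sM : star_subalgebra dot M).
Variables (e : nat -> nat -> nat -> H -> H) (he : matrix_units dot M e).
Implicit Types (S T : H -> H) (n i j k : nat) (s t : bool).

Lemma unit_index_child n k s : unit_index n k -> unit_index n.+1 (2 * k - s).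
Proof. by rewrite /unit_index expnS; case: s; lia. Qed.

(* The 2x2 matrix units of the (n+1)-st tensor factor, which commute with R_n;
   the boolean [true] stands for the index 1 and [false] for 2. *)
Definition tail_unit n s t : H -> H :=
  \sum_(1 <= k < (2 ^ n).+1) e n.+1 (2 * k - s)%N (2 * k - t)%N.

(** The boolean [b] carries the second Kronecker delta, so that the coefficient has the shape
    produced by [child_eq]. *)
Lemma sum_unit_single n k (b : bool) (F : nat -> H -> H) : unit_index n k ->
  \sum_(1 <= l < (2 ^ n).+1) ((l == k) && b)%:R *: F l = b%:R *: F k.
Proof.
move=> hk; rewrite (bigD1_seq k) /= ?iota_uniq // ?eqxx; last first.
  by rewrite mem_index_iota; move: hk; rewrite /unit_index; lia.
rewrite big1 ?addr0 // => l /negPf ->; by rewrite scale0r.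
Qed.

(** For positive [k] the pairs 2k-1, 2k are disjoint, so an index of level n+1 encodes an index of
    level n together with a boolean. *)
Lemma child_eq n k l s t : unit_index n k -> unit_index n l ->
  (2 * l - s == 2 * k - t)%N = (l == k) && (s == t).
Proof. by rewrite /unit_index; case: s; case: t; lia. Qed.

Lemma unit_split n i j : unit_index n i -> unit_index n j ->
  e n i j = e n.+1 (2 * i - true)%N (2 * j - true)%N +
            e n.+1 (2 * i - false)%N (2 * j - false)%N.
Proof. by move=> hi hj; rewrite (mu_split he hi hj) !subn0. Qed.

Lemma unit_linear n i j : unit_index n i -> unit_index n j -> linear (e n i j).
Proof. by move=> hi hj; apply: (star_linear sM); apply: (mu_in he). Qed.

Lemma tail_unit_in_M n s t : M (tail_unit n s t).
Proof.
rewrite /tail_unit big_nat_cond; apply: (star_sum sM) => k /andP[hk _].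
by apply: (mu_in he); apply: unit_index_child; rewrite /unit_index; lia.
Qed.

Lemma tail_unit_linear n s t : linear (tail_unit n s t).
Proof. exact: star_linear sM _ (tail_unit_in_M n s t). Qed.

(** Reading the index 2k-u as the pair (k, u), a tail unit acts on [u] and leaves [k] alone. *)
Lemma tail_unit_mul_unit n s t (u : bool) k x : unit_index n k -> unit_index n.+1 x ->
  tail_unit n s t \o e n.+1 (2 * k - u)%N x = (t == u)%:R *: e n.+1 (2 * k - s)%N x.
Proof.
move=> hk hx; rewrite comp_suml -(sum_unit_single _ (fun l => e n.+1 (2 * l - s)%N x) hk).
apply: eq_big_nat => l hl; have hl' : unit_index n l by rewrite /unit_index; lia.
by rewrite (mu_mul he) ?(child_eq _ _ hk hl') //; apply: unit_index_child.
Qed.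

Lemma unit_mul_tail_unit n s t (u : bool) k x : unit_index n k -> unit_index n.+1 x ->
  e n.+1 x (2 * k - u)%N \o tail_unit n s t = (s == u)%:R *: e n.+1 x (2 * k - t)%N.
Proof.
move=> hk hx; rewrite comp_sumr; last exact: unit_linear hx (unit_index_child _ hk).
rewrite -(sum_unit_single _ (fun l => e n.+1 x (2 * l - t)%N) hk).
apply: eq_big_nat => l hl; have hl' : unit_index n l by rewrite /unit_index; lia.
by rewrite (mu_mul he) 1?eq_sym ?(child_eq _ _ hk hl') //; apply: unit_index_child.
Qed.

Lemma tail_unit_mul n s t s' t' :
  tail_unit n s t \o tail_unit n s' t' = (t == s')%:R *: tail_unit n s t'.
Proof.
rewrite {2}/tail_unit comp_sumr; last exact: tail_unit_linear.
rewrite scaler_sumr; apply: eq_big_nat => k hk.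
have hk' : unit_index n k by rewrite /unit_index; lia.
by rewrite tail_unit_mul_unit // unit_index_child.
Qed.

Lemma tail_unit_adj n s t : is_adjoint dot (tail_unit n s t) (tail_unit n t s).
Proof.
rewrite /tail_unit big_nat_cond [X in is_adjoint _ _ X]big_nat_cond.
apply: adjoint_sum => k /andP[hk _].
by apply: (mu_adj he); apply: unit_index_child; rewrite /unit_index; lia.
Qed.

Lemma tail_unit_sum n : tail_unit n true true + tail_unit n false false = idfun.
Proof.
rewrite -(mu_sum he n) /tail_unit -big_split; apply: eq_big_nat => k hk.
have hk' : unit_index n k by rewrite /unit_index; lia.
by rewrite (unit_split hk' hk').
Qed.

(** After splitting [e n i j] at level n+1, both products reduce to the single unit with indices
    2i-s and 2j-t. *)
Lemma tail_unit_commute_unit n s t i j : unit_index n i -> unit_index n j ->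
  e n i j \o tail_unit n s t = tail_unit n s t \o e n i j.
Proof.
move=> hi hj; have lD := tail_unit_linear n s t.
rewrite unit_split // comp_addr //.
rewrite !tail_unit_mul_unit ?unit_index_child //.
have -> (T T' : H -> H) : (T + T') \o tail_unit n s t = (T \o tail_unit n s t) + (T' \o tail_unit n s t) by [].
rewrite !unit_mul_tail_unit ?unit_index_child //.
by case: s {lD}; case: t; rewrite ?scale0r ?scale1r ?addr0 ?add0r.
Qed.

(** * The algebras R_n and their commutation with the next tensor factor *)

Definition units n : set (H -> H) :=
  [set T | exists i j, [/\ unit_index n i, unit_index n j & T = e n i j]].

Lemma units_in_M n : units n `<=` M.
Proof. by move=> _ [i [j [hi hj ->]]]; apply: (mu_in he). Qed.

Lemma R_star n : star_subalgebra dot (R_ dot e n).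
Proof. exact (star_generated_subalgebra sM (@units_in_M n)). Qed.

Lemma R_unit n i j : unit_index n i -> unit_index n j -> R_ dot e n (e n i j).
Proof. by move=> hi hj A _; apply; exists i, j. Qed.

Lemma R_sub_M n : R_ dot e n `<=` M.
Proof. by move=> T RT; apply: (RT _ sM); exact: units_in_M. Qed.

Lemma R_linear n T : R_ dot e n T -> linear T.
Proof. by move=> /R_sub_M; exact: (star_linear sM). Qed.

Lemma R_mono m n : (m <= n)%N -> R_ dot e m `<=` R_ dot e n.
Proof.
elim: n => [|n IH]; first by rewrite leqn0 => /eqP ->.
rewrite leq_eqVlt => /predU1P[-> //|/IH mn]; apply: subset_trans mn _ => T RT.
apply: (RT _ (R_star n.+1)) => _ [i [j [hi hj ->]]]; rewrite unit_split //.
by apply: (star_add (R_star n.+1)); apply: R_unit; apply: unit_index_child.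
Qed.

Lemma tail_unit_in_R n s t : R_ dot e n.+1 (tail_unit n s t).
Proof.
rewrite /tail_unit big_nat_cond; apply: (star_sum (R_star n.+1)) => k /andP[hk _].
by apply: R_unit; apply: unit_index_child; rewrite /unit_index; lia.
Qed.

(** The adjoint of a tail unit is a tail unit, so commutation with the generators of R_n
    suffices. *)
Lemma tail_unit_commute n s t T : R_ dot e n T ->
  T \o tail_unit n s t = tail_unit n s t \o T.
Proof.
apply: (star_generated_commute sM (@units_in_M n) (tail_unit_in_M n s t) (tail_unit_adj n s t)).
by move=> _ [i [j [hi hj ->]]]; rewrite !tail_unit_commute_unit.
Qed.

(** The unipotent matrix 1 + cN of the (n+1)-st tensor factor: with k = n+1, N_k is
    [tail_unit n true false] and q_k is [tail_unit n false false]. *)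
Definition shear (c : K[i]) n : H -> H := idfun + c *: tail_unit n true false.

Lemma shear_in_R c n : R_ dot e n.+1 (shear c n).
Proof.
apply: (star_add (R_star n.+1)); first exact: star_one (R_star n.+1).
by apply: (star_scale (R_star n.+1)); exact: tail_unit_in_R.
Qed.

Lemma shear_commute c n T x : R_ dot e n T -> T (shear c n x) = shear c n (T x).
Proof.
move=> RT; have lT := R_linear RT; suff: T \o shear c n = shear c n \o T.
  by rewrite funeqE => /(_ x).
by rewrite comp_addr // comp_scaler // tail_unit_commute.
Qed.

(** N squares to zero, hence (1 + cN)(1 - cN) = 1. *)
Lemma shearK c n : cancel (shear (- c) n) (shear c n).
Proof.
have lD := tail_unit_linear n true false.
suff: shear c n \o shear (- c) n = idfun by rewrite funeqE.
have -> : shear c n \o shear (- c) n =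
    shear (- c) n + c *: (tail_unit n true false \o shear (- c) n) by [].
rewrite comp_addr // comp_scaler // tail_unit_mul scale0r scaler0 addr0.
by rewrite /shear -addrA scaleNr addNr addr0.
Qed.

(** Here Nq = N, while qN and NN vanish. *)
Lemma shear_tail_unit c n : shear c n \o tail_unit n false false \o shear (- c) n =
  tail_unit n false false + c *: tail_unit n true false.
Proof.
have lD s t := tail_unit_linear n s t.
have -> : shear c n \o tail_unit n false false = tail_unit n false false +
    c *: (tail_unit n true false \o tail_unit n false false) by [].
rewrite tail_unit_mul scale1r.
have -> T T' U : (T + c *: T') \o U = (T \o U) + c *: (T' \o U) by [].
rewrite /shear !comp_addr // !comp_scaler // !tail_unit_mul !scale0r !scaler0 !addr0.
by [].
Qed.

(** * Conjugation by the first n shears and the automorphism of the union *)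

Fixpoint twist n : H -> H :=
  if n is m.+1 then twist m \o shear m.+1%:R m else idfun.

Fixpoint untwist n : H -> H :=
  if n is m.+1 then shear (- m.+1%:R) m \o untwist m else idfun.

Lemma twist_in_R n : R_ dot e n (twist n).
Proof.
elim: n => [|n IH]; first exact: star_one (R_star 0).
by apply: (star_mul (R_star n.+1)); [apply: (R_mono (leqnSn n))|apply: shear_in_R].
Qed.

Lemma untwist_in_R n : R_ dot e n (untwist n).
Proof.
elim: n => [|n IH]; first exact: star_one (R_star 0).
by apply: (star_mul (R_star n.+1)); [apply: shear_in_R|apply: (R_mono (leqnSn n))].
Qed.

Lemma twistK n : cancel (untwist n) (twist n).
Proof. by elim: n => [//|n IH] x /=; rewrite shearK IH. Qed.

Lemma untwistK n : cancel (twist n) (untwist n).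
Proof.
elim: n => [//|n IH] x /=; rewrite IH.
by have := shearK (- n.+1%:R) n x; rewrite opprK.
Qed.

Definition twist_conj n T : H -> H := twist n \o T \o untwist n.

(** Each shear beyond level m commutes with [T] and so cancels against its inverse. *)
Lemma twist_conj_stable m n T : (m <= n)%N -> R_ dot e m T ->
  twist_conj n T = twist_conj m T.
Proof.
move=> /subnK <- RT; elim: (n - m)%N => [//|k IH]; rewrite addSn -IH.
have RT' : R_ dot e (k + m) T by apply: R_mono RT; apply: leq_addl.
by apply/funext => x; rewrite /twist_conj /= -shear_commute // shearK.
Qed.

Lemma twist_conj_in_R n T : R_ dot e n T -> R_ dot e n (twist_conj n T).
Proof.
move=> RT; have sR := R_star n.
apply: (star_mul sR); last exact: untwist_in_R.
by apply: (star_mul sR) => //; exact: twist_in_R.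
Qed.

(** The innermost shear turns q into [U]; the remaining ones make up [twist n], which lies in R_n
    and therefore commutes with [U]. *)
Lemma twist_conj_tail_unit n :
  twist_conj n.+1 (tail_unit n false false) =
  tail_unit n false false + n.+1%:R *: tail_unit n true false.
Proof.
pose U := tail_unit n false false + n.+1%:R *: tail_unit n true false.
have RU : twist n \o U = U \o twist n.
  have lw := R_linear (@twist_in_R n); have Rw := @twist_in_R n.
  by rewrite comp_addr // comp_scaler // !tail_unit_commute.
have := shear_tail_unit n.+1%:R n; rewrite -/U funeqE => conjE.
apply/funext => x; rewrite /twist_conj /=.
have /= -> := conjE (untwist n x).
by move: RU; rewrite funeqE => /(_ (untwist n x)) /= ->; rewrite twistK.
Qed.

(* By [twist_conj_stable] any [n] with [T] in [R_n] gives the same value. *)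
Definition twist_aut T : H -> H :=
  twist_conj (xget 0%N [set n | (1 <= n)%N /\ R_ dot e n T]) T.

Lemma twist_autE n T : (1 <= n)%N -> R_ dot e n T -> twist_aut T = twist_conj n T.
Proof.
move=> n1 RT; rewrite /twist_aut; set m := xget _ _.
have [_ RmT] : (1 <= m)%N /\ R_ dot e m T by apply: (@xgetPex _ 0%N [set n | (1 <= n)%N /\ R_ dot e n T]); exists n.
(* The chosen index [m] and the given [n] are compared at level [maxn m n]. *)
rewrite -(twist_conj_stable (leq_maxl m n) RmT).
by rewrite -(twist_conj_stable (leq_maxr m n) RT).
Qed.

(** Two elements always lie in a common R_n, on which the map is conjugation by the invertible
    [twist n]. As [twist n] and its inverse both belong to R_n, the inverse conjugation preserves
    R_n, which gives surjectivity. *)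
Lemma twist_aut_automorphism : algebra_automorphism (Rinf dot e) twist_aut.
Proof.
have common S T : Rinf dot e S -> Rinf dot e T ->
    exists n, [/\ (1 <= n)%N, R_ dot e n S & R_ dot e n T].
  move=> [m /= m1 RS] [n /= n1 RT]; exists (maxn m n); split.
  - by rewrite leq_max m1.
  - exact: R_mono (leq_maxl m n) _ RS.
  - exact: R_mono (leq_maxr m n) _ RT.
split.
- split.
  + move=> T [n /= n1 RT]; exists n => //.
    by rewrite (twist_autE n1 RT); apply: twist_conj_in_R.
  + move=> S T /set_mem RS /set_mem RT.
    have [n [n1 {}RS {}RT]] := common _ _ RS RT.
    rewrite (twist_autE n1 RS) (twist_autE n1 RT) => eqST.
    suff E U : U = untwist n \o twist_conj n U \o twist n by rewrite (E S) (E T) eqST.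
    by apply/funext => x; rewrite /twist_conj /= !untwistK.
  + move=> T [n /= n1 RT]; have sR := R_star n.
    have RS : R_ dot e n (untwist n \o T \o twist n).
      apply: (star_mul sR); last exact: twist_in_R.
      by apply: (star_mul sR) => //; exact: untwist_in_R.
    exists (untwist n \o T \o twist n); first by exists n.
    by rewrite (twist_autE n1 RS); apply/funext => x; rewrite /twist_conj /= !twistK.
- move=> a S T RS RT; have [n [n1 {}RS {}RT]] := common _ _ RS RT.
  have lw := R_linear (@twist_in_R n).
  rewrite (twist_autE n1 RS) (twist_autE n1 RT) (twist_autE n1); last exact: (star_lin (R_star n)).
  by rewrite /twist_conj comp_addr // comp_scaler.
- move=> S T RS RT; have [n [n1 {}RS {}RT]] := common _ _ RS RT.
  rewrite (twist_autE n1 RS) (twist_autE n1 RT) (twist_autE n1); last exact: (star_mul (R_star n)).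
  by apply/funext => x; rewrite /twist_conj /= untwistK.
Qed.

End Twist.

(** * Neighbourhoods in measure and trace estimates *)

Section Measure.
Variables (K : realType) (H : completeNormedModType K[i]).
Variables (dot : {dot H for @Num.conj K[i]}) (hH : is_hilbert dot).
Variables (M : set (H -> H)) (sM : star_subalgebra dot M).
Implicit Types (S T : H -> H) (u v : H).

Lemma dot_ge0 u : 0 <= dot u u.
Proof. by rewrite -hH exprn_ge0. Qed.

Lemma le_norm_dot (c : K) u v : 0 <= c ->
  (`|u| <= c%:C * `|v|) = (dot u u <= (c ^+ 2)%:C * dot v v).
Proof.
move=> c0; rewrite -!hH rmorphXn -exprMn ler_pXn2r // nnegrE ?mulr_ge0 //.
by rewrite ler0c.
Qed.

Lemma bounded_op_continuous T : bounded_op T -> continuous T.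
Proof.
move=> [lT [c hc]] u.
have Tsub v w : T v - T w = T (v - w).
  by have := lT (-1) w v; rewrite !scaleN1r ![- _ + _]addrC.
(* The bound [c] may be zero or negative; a positive one is needed to divide by. *)
have c1 : 0 < (`|c| + 1)%:C by rewrite ltcR ltr_wpDl.
apply/cvgrPdist_lt => /= eps eps0; near=> v.
rewrite Tsub; apply: le_lt_trans (hc _) _.
apply: (@le_lt_trans _ _ ((`|c| + 1)%:C * `|u - v|)).
  rewrite ler_wpM2r // lecR (le_trans (ler_norm _)) // lerDl //.
rewrite -ltr_pdivlMl //; near: v; apply: cvgr_dist_lt => //.
by rewrite mulr_gt0 // invr_gt0.
Unshelve. all: by end_near. Qed.

Lemma graph_closed T : bounded_op T -> closed (graph T).
Proof.
move=> bT; have -> : graph T = (fun p : H * H => p.2 - T p.1) @^-1` [set 0].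
  apply/seteqP; split=> p /=; first by rewrite /graph /= => ->; rewrite subrr.
  by move/eqP; rewrite subr_eq0 => /eqP.
apply: preimage_closed; last first.
  by apply: accessible_closed_set1; apply: hausdorff_accessible; exact: norm_hausdorff.
move=> p _; apply: cvgB; first exact: cvg_snd.
by apply: continuous_comp; [exact: cvg_fst | exact: bounded_op_continuous].
Qed.

Lemma graph_affiliated T : M T -> affiliated M (graph T).
Proof.
move=> MT; have lT := star_linear sM MT; have T0 := linear_fun0 lT; split.
  split.
  - by rewrite /graph /= T0.
  - by move=> a u v u' v'; rewrite /graph /= => -> ->; rewrite lT.
  - by move=> v; rewrite /graph /= T0.
  - by move=> O [u Ou] _; exists u; split => //; exists (T u).
  - exact: graph_closed (star_bounded sM MT).
move=> S [_ comm] u v; rewrite /graph /= => ->.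
by have := comm _ MT; rewrite funeqE => /(_ u).
Qed.

(** Reduces membership in a neighbourhood of the zero operator to membership in a measure ball; the
    closure adds nothing because the graph is closed. *)
Lemma strong_sub_graph0 T : M T -> strong_sub (graph T) (graph 0) = graph T.
Proof.
move=> MT; rewrite [RHS](proj1 (closure_id _) (graph_closed (star_bounded sM MT))).
congr closure; apply/seteqP; split=> p /=.
  by move=> [v [w []]]; rewrite /graph /= => -> -> ->; rewrite subr0.
by move=> pT; exists (T p.1), 0; split => //; rewrite subr0.
Qed.

Lemma op_norm_le T (c : K) : 0 <= c -> (forall u, `|T u| <= c%:C * `|u|) -> op_norm T <= c.
Proof. by move=> c0 hc; apply: ge_inf; [exists 0 => x [] | split]. Qed.

Lemma op_norm_lt T (r : K) : bounded_op T -> op_norm T < r ->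
  exists2 c : K, 0 <= c < r & forall u, `|T u| <= c%:C * `|u|.
Proof.
move=> [_ [c hc]] /inf_lt[|d [d0 hd] dr]; last by exists d; rewrite ?d0.
exists `|c|; split => // u; apply: le_trans (hc u) _.
by rewrite ler_wpM2r // lecR ler_norm.
Qed.

Lemma projection_compl p : projection dot M p -> projection dot M (idfun - p).
Proof.
move=> [Mp pp adj]; have lp := star_linear sM Mp; split.
- by apply: (star_sub sM) => //; exact: star_one sM.
- apply/funext => u; have := congr1 (@^~ u) pp => /= ppu.
  have pu : p (u - p u) = 0.
    by have := lp (-1) (p u) u; rewrite !scaleN1r [- p u + u]addrC ppu addNr.
  by rewrite [LHS](_ : _ = (u - p u) - p (u - p u)) // pu subr0.
- move=> u v; have -> : (idfun - p) u = u - p u by [].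
  by have -> : (idfun - p) v = v - p v by []; rewrite dotBl dotBr adj.
Qed.

Lemma dot_projection p u : projection dot M p -> dot (p u) (p u) = dot (p u) u.
Proof. by move=> [_ pp adj]; rewrite -adj; have := congr1 (@^~ u) pp => /= ->. Qed.

(** The difference of the two sides is the squared norm of (1 - p)u. *)
Lemma projection_contraction p u : projection dot M p -> dot (p u) (p u) <= dot u u.
Proof.
move=> hp; rewrite (dot_projection _ hp) -subr_ge0 -dotBl.
by have := dot_projection u (projection_compl hp) => /= <-; exact: dot_ge0.
Qed.

Variables (tau : (H -> H) -> K[i]) (htau : faithful_normal_trace dot M tau).

Lemma trace_add S T : M S -> M T -> tau (S + T) = tau S + tau T.
Proof. by move=> MS MT; rewrite -[S in LHS]scale1r (trace_lin htau) // mul1r. Qed.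

Lemma trace_zero : tau 0 = 0.
Proof.
have M0 := star_zero sM; apply: (addrI (tau 0)).
by rewrite -trace_add // !addr0.
Qed.

Lemma trace_scale a T : M T -> tau (a *: T) = a * tau T.
Proof.
move=> MT; have M0 := star_zero sM.
by rewrite -[a *: T]addr0 (trace_lin htau) // trace_zero addr0.
Qed.

Lemma trace_le S T : M S -> M T -> op_le dot S T -> tau S <= tau T.
Proof.
move=> MS MT ST; rewrite -subr_ge0.
have -> : tau T - tau S = tau (T - S).
  by rewrite addrC -mulN1r -(trace_lin htau) // scaleN1r addrC.
apply: (trace_ge0 htau); first exact: (star_sub sM).
by move=> u; rewrite subr0; exact: ST.
Qed.

(** By cyclicity tau(qp) = tau(pqp), and the quadratic form of pqp at u is the squared norm of qpu;
    the hypothesis thus says that pqp is below [X]. *)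
Lemma trace_compression p q X : projection dot M p -> projection dot M q -> M X ->
  (forall u, dot (q (p u)) (q (p u)) <= dot (X u) u) -> tau (q \o p) <= tau X.
Proof.
move=> hp hq MX le_X; have [Mp pp adjp] := hp; have [Mq qq adjq] := hq.
have Mqp : M (q \o p) by exact: (star_mul sM).
have -> : tau (q \o p) = tau (p \o (q \o p)).
  rewrite [RHS](trace_cyclic htau) //; congr tau; apply/funext => u /=.
  by have := congr1 (@^~ u) pp => /= ->.
apply: trace_le => //; first by apply: (star_mul sM).
move=> u.
have -> : (X - (p \o (q \o p))) u = X u - p (q (p u)) by [].
by rewrite dotBl subr_ge0 adjp -(dot_projection _ hq).
Qed.

Lemma graph_measure_ball T (c eps del : K) : M T -> 0 <= c <= eps -> 0 <= del ->
  (forall u, `|T u| <= c%:C * `|u|) -> measure_ball dot M tau eps del (graph T).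
Proof.
move=> MT /andP[c0 ceps] del0 hc; split; first exact: graph_affiliated.
(* For an operator small in norm the identity serves as the projection. *)
exists idfun; split.
- by split => //; exact: star_one sM.
- by rewrite subrr trace_zero ler0c.
- exists T; split => //; exact: le_trans (op_norm_le c0 hc) ceps.
Qed.

(* If [T p = b] has norm less than [r], so has [q p = A b]; and [q (1 - p)] is
   controlled by [1 - p]. *)
Lemma measure_ball_trace A T q (eps del r : K) :
  (forall u, dot (A u) (A u) <= dot u u) -> projection dot M q -> A \o T = q ->
  eps < r -> measure_ball dot M tau eps del (graph T) ->
  tau q <= (r ^+ 2 + del)%:C.
Proof.
move=> contrA hq ATq epsr [_ [p [hp taup [b [Mb Tpb nb]]]]].
(* [op_norm] is an infimum; the gap between [eps] and [r] yields an actual bound below [r]. *)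
have [c /andP[c0 cr] hc] := op_norm_lt (star_bounded sM Mb) (le_lt_trans nb epsr).
have [Mp pp _] := hp; have [Mq _ _] := hq; have hp' := projection_compl hp.
have [Mp' _ _] := hp'.
have Tp u : T (p u) = b u.
  by have : comp_op (graph T) p (u, b u) by rewrite Tpb.
have lq := star_linear sM Mq.
have -> : tau q = tau (q \o p) + tau (q \o (idfun - p)).
  rewrite -trace_add; [|exact: (star_mul sM)..]; congr tau.
  by rewrite -comp_addr // addrC subrK.
have -> : (r ^+ 2 + del)%:C = (r ^+ 2)%:C + del%:C by rewrite rmorphD.
apply: lerD.
  (* Since q p = A b and [A] is a contraction, qpu has norm at most r times that of u: compare with
     r^2 times the identity. *)
  have -> : (r ^+ 2)%:C = tau ((r ^+ 2)%:C *: idfun).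
    by rewrite trace_scale ?(trace_one htau) ?mulr1 //; exact: star_one sM.
  apply: trace_compression => // [|u]; first by apply: (star_scale sM); exact: star_one sM.
  have -> : ((r ^+ 2)%:C *: idfun) u = (r ^+ 2)%:C *: u by [].
  rewrite dotZl -ATq /= Tp; apply: le_trans (contrA _) _.
  rewrite -le_norm_dot; last by rewrite (le_trans c0) // ltW.
  by apply: le_trans (hc u) _; rewrite ler_wpM2r // lecR ltW.
(* For the part q(1 - p) the comparison operator is 1 - p itself. *)
apply: le_trans taup; apply: trace_compression => // u.
by rewrite -(dot_projection _ hp'); exact: projection_contraction.
Qed.

End Measure.

(** * Norm and trace of the tail units *)

Section TailTrace.
Variables (K : realType) (H : completeNormedModType K[i]).
Variables (dot : {dot H for @Num.conj K[i]}) (hH : is_hilbert dot).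
Variables (M : set (H -> H)) (sM : star_subalgebra dot M).
Variables (e : nat -> nat -> nat -> H -> H) (he : matrix_units dot M e).
Variables (tau : (H -> H) -> K[i]) (htau : faithful_normal_trace dot M tau).

Lemma tail_unit_projection n s : projection dot M (tail_unit e n s s).
Proof.
split; [exact: (tail_unit_in_M sM he) | | exact: (tail_unit_adj he)].
by rewrite (tail_unit_mul sM he) eqxx scale1r.
Qed.

(** The adjoint times the operator is the projection [tail_unit e n t t]. *)
Lemma tail_unit_contraction n s t u :
  dot (tail_unit e n s t u) (tail_unit e n s t u) <= dot u u.
Proof.
have := tail_unit_mul sM he n t s s t; rewrite eqxx scale1r funeqE => /(_ u) /= tsst.
rewrite (tail_unit_adj he n s t) tsst -(tail_unit_adj he n t t).
have ht := tail_unit_projection n t.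
by rewrite -(dot_projection _ ht); exact: (projection_contraction hH sM).
Qed.

(** The two diagonal units are the products of the off-diagonal ones in either order, so they have
    equal trace, and they sum to 1. *)
Lemma tail_unit_trace n : tau (tail_unit e n false false) = 2^-1.
Proof.
have inM := tail_unit_in_M sM he n.
have := trace_cyclic htau (inM true false) (inM false true).
rewrite !(tail_unit_mul sM he) !eqxx !scale1r => tr_eq.
have := trace_one htau; rewrite -(tail_unit_sum he n) (trace_add htau) // tr_eq.
move=> tr_sum; have two0 : 2 != 0 :> K[i] by rewrite pnatr_eq0.
by apply: (mulfI two0); rewrite mulfV // mulr_natl mulr2n.
Qed.

End TailTrace.

(** * Discontinuity of the twist at zero *)

Theorem theorem4p5 (K : realType) (H : completeNormedModType K[i])
    (dot : {dot H for @Num.conj K[i]}) (hH : is_hilbert dot)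
    (M : set (H -> H)) (hM : hyperfinite_II1_factor dot M)
    (tau : (H -> H) -> K[i]) (htau : faithful_normal_trace dot M tau)
    (e : nat -> nat -> nat -> H -> H) (he : matrix_units dot M e) :
  exists Phi : (H -> H) -> (H -> H),
    algebra_automorphism (Rinf dot e) Phi /\
    ~ measure_continuous dot M tau (Rinf dot e) Phi.
Proof.
have sM : star_subalgebra dot M by case: hM => -[[[]]].
exists (twist_aut dot e); split; first exact: (twist_aut_automorphism sM he).
have R0 : R_ dot e 1 0 by exact: star_zero (R_star sM he 1).
have Rinf0 : Rinf dot e 0 by exists 1%N.
have Phi0 : twist_aut dot e 0 = 0.
  rewrite (twist_autE sM he (leqnn 1) R0); apply/funext => x.
  exact: (linear_fun0 (R_linear sM he (twist_in_R sM he (n := 1)))).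
move=> /(_ 0 Rinf0); rewrite Phi0 => cont.
(* These constants are refuted with r = 1/2, which exceeds 1/4: the trace bound would give 1/2 <=
   1/4 + 1/8. *)
pose W := [set Y | affiliated M Y /\
  measure_ball dot M tau 4^-1 8^-1 (strong_sub Y (graph 0))].
have W_nbhs : measure_nbhs dot M tau (graph 0) W.
  by exists (4^-1, 8^-1) => //=; split; rewrite invr_gt0 ltr0n.
have [|U [[eps del] /= [eps0 del0] UW] sub] := cont (Rinf dot e `&` @graph K H @^-1` W).
  by exists W.
(* The tensor factor k = n+1 is taken so far out that q_k / k has norm at most [eps]. *)
have [n n_eps] : exists n : nat, n.+1%:R^-1 <= eps.
  exists (Num.truncn eps^-1); rewrite invf_ple ?posrE ?ltr0n //.
  by rewrite ltW // truncnS_gt.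
pose q := tail_unit e n false false; pose c : K[i] := n.+1%:R^-1.
have Rq : R_ dot e n.+1 q by exact: (tail_unit_in_R sM he).
have sR := R_star sM he n.+1.
have Rcq : R_ dot e n.+1 (c *: q) by exact: (star_scale sR).
have Mcq : M (c *: q) by exact: (R_sub_M sM he Rcq).
have c_real : c = (n.+1%:R^-1)%:C by rewrite /c fmorphV rmorph_nat.
have cq_bound u : `|(c *: q) u| <= (n.+1%:R^-1)%:C * `|u|.
  have -> : (c *: q) u = c *: q u by [].
  rewrite normrZ c_real ger0_norm ?ler0c ?invr_ge0 //.
  rewrite ler_wpM2l ?ler0c ?invr_ge0 //.
  have := le_norm_dot hH (q u) u ler01; rewrite rmorph1 mul1r expr1n => ->.
  by rewrite mul1r; exact: (tail_unit_contraction hH sM he).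
have /sub : (Rinf dot e `&` @graph K H @^-1` U) (c *: q).
  split; first by exists n.+1.
  apply: UW; split; first exact: (graph_affiliated sM).
  rewrite (strong_sub_graph0 sM) //.
  apply: (graph_measure_ball sM htau Mcq _ (ltW del0) cq_bound).
  by rewrite invr_ge0 ler0n.
rewrite /preimage /= => -[_ [_]].
(* The scalar 1/(n+1) cancels the coefficient n+1 of the shear, so N appears with coefficient 1
   whatever [n] is. *)
have -> : twist_aut dot e (c *: q) = c *: q + tail_unit e n true false.
  have [_ aut_lin _] := twist_aut_automorphism sM he.
  have := aut_lin c q 0; rewrite addr0 Phi0 addr0 => ->; [|by exists n.+1|by []].
  rewrite (twist_autE sM he _ Rq) // (twist_conj_tail_unit sM he).
  by rewrite scalerDr scalerA mulVf ?scale1r // pnatr_eq0.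
have Mtail s t : M (tail_unit e n s t) by exact: (tail_unit_in_M sM he).
rewrite (strong_sub_graph0 sM); last exact: (star_add sM).
(* The contraction [A] is the adjoint of N: it kills q and sends N to q. *)
move=> /(measure_ball_trace hH sM htau (A := tail_unit e n false true) (q := q) (r := 2^-1)).
rewrite /q (tail_unit_trace sM he htau).
have -> : 2^-1 = (2^-1)%:C :> K[i] by rewrite fmorphV rmorph_nat.
rewrite lecR => bound.
have : 2^-1 <= (2^-1) ^+ 2 + 8^-1 :> K.
  apply: bound.
  - exact: (tail_unit_contraction hH sM he).
  - exact: (tail_unit_projection sM he).
  - have lA := tail_unit_linear sM he n false true.
    rewrite comp_addr // comp_scaler // !(tail_unit_mul sM he).
    by rewrite scale0r scaler0 add0r scale1r.
  - lra.
lra.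
Qed.
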